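(* Let $\varphi\in SE$ with $\eta$-index $\rho=\rho_\varphi>0$ and let $h:\mathbb{R}\to\mathbb{R}$. If $\mathbb{A}_{\mathrm u}$ is dense in $\mathbb{G}_+^\rho$ and $H^\dagger(t)=K(t)$ for all $t\in\mathbb{A}_{\mathrm u}$ (i.e. $H^\dagger:(\mathbb{A}_{\mathrm u},\circ_\rho)\to(\mathbb{R},+)$ is a homomorphism), then $\mathbb{A}_{\mathrm u}=\mathbb{G}_+^\rho$ and for some $c\in\mathbb{R}$ $$H^\dagger(t)=c\log(1+\rho t)\qquad(t>\rho^* ).$$
   Context: A function $\varphi:(0,\infty)\to(0,\infty)$ is self-equivarying, written $\varphi\in SE$, if $\varphi(x)=O(x)$ as $x\to\infty$ and there is a function $\eta=\eta^\varphi:[0,\infty)\to(0,\infty)$ such that $\varphi(x+t\varphi(x))/\varphi(x)\to\eta(t)$ as $x\to\infty$, locally uniformly in $t\in[0,\infty)$. It is known that then $\eta(t)=1+\rho t$ for some $\rho\ge 0$, called the $\eta$-index $\rho_\varphi$ of $\varphi$. For $\rho>0$ put $\rho^*:=-1/\rho$ and $\mathbb{G}_+^\rho:=(\rho^*,\infty)$, which is an abelian group under the Popa operation $s\circ_\rho t:=s+t(1+\rho s)$, with neutral element $0$ and inverse $u\mapsto -u/(1+\rho u)$. $K(t):=\lim_{x\to\infty}[h(x+t\varphi(x))-h(x)]$ for those $t>\rho^*$ for which the limit exists and is finite. $\mathbb{A}_{\mathrm u}$ is the set of those $t>\rho^*$ for which this finite limit exists and the convergence is uniform near $t$, i.e.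 for every $\varepsilon>0$ there are $\delta>0$ and $X$ such that $|h(x+s\varphi(x))-h(x)-K(t)|<\varepsilon$ for all $x>X$ and all $s\in(t-\delta,t+\delta)$. For $t>\rho^*$, $$H^\dagger(t):=\lim_{\delta\downarrow 0}\limsup_{x\to\infty}\,\sup\{h(x+s\varphi(x))-h(x): s\in[t,t+\delta)\}.$$ *)

(* Defs.v *)
(* MathComp / MathComp-Analysis *)
From mathcomp Require Import all_boot all_order all_algebra.
From mathcomp Require Import all_classical all_reals all_analysis.
Import Order.TTheory GRing.Theory Num.Theory.
Import numFieldNormedType.Exports.

Set Implicit Arguments.
Unset Strict Implicit.
Unset Printing Implicit Defensive.

Local Open Scope classical_set_scope.
Local Open Scope ring_scope.

Section SelfEquivarying.
Context {R : realType}.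
Implicit Types (phi h eta : R -> R) (rho t : R).

(* A function (0, oo) -> (0, oo) is encoded as a total function R -> R that is
   positive on `]0, +oo[; all the notions below are limits at +oo and do not
   depend on its values on `]-oo, 0]. Likewise eta : [0, oo) -> (0, oo) is only
   constrained on `[0, +oo[. *)

(* Local uniformity on [0, oo): every point of [0, oo) has a neighbourhood in
   [0, oo) on which the convergence is uniform. *)
Definition is_eta phi eta : Prop :=
  (forall t, 0 <= t -> 0 < eta t) /\
  forall t, 0 <= t -> exists2 A, nbhs t A &
    {uniform A `&` `[0, +oo[,
       (fun x s : R => phi (x + s * phi x) / phi x) @ +oo --> eta}.

Definition self_equivarying phi : Prop :=
  [/\ forall x, 0 < x -> 0 < phi x,
      exists2 C : R, 0 < C & \forall x \near +oo, `|phi x| <= C * `|x| &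
      exists eta, is_eta phi eta].

Definition is_eta_index phi rho : Prop :=
  0 <= rho /\
  exists2 eta, is_eta phi eta & forall t, 0 <= t -> eta t = 1 + rho * t.

Definition rho_star rho : R := - rho^-1.

Definition Gplus rho : set R := `]rho_star rho, +oo[.

Definition Kincr phi h t (x : R) : R := h (x + t * phi x) - h x.

(* Only meaningful when the limit exists in R, which is required in Au. *)
Definition K phi h t : R := lim (Kincr phi h t x @[x --> +oo]).

Definition Au rho phi h : set R :=
  [set t | [/\ Gplus rho t,
      cvg (Kincr phi h t x @[x --> +oo]) &
      forall e : R, 0 < e -> exists2 d : R, 0 < d &
        \forall x \near +oo, forall s, s \in `]t - d, t + d[ ->
          `|Kincr phi h s x - K phi h t| < e]].

(* The inner expression is nondecreasing in d, so this limit always exists in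
   the extended reals. *)
Definition Hdag phi h t : \bar R :=
  lim (limf_esup
         (fun x : R => ereal_sup [set (Kincr phi h s x)%:E | s in `[t, t + d[])
         +oo @[d --> 0^'+]).

End SelfEquivarying.

(* Main.v *)
Require Import Defs.
From HB Require Import structures.
From mathcomp Require Import all_boot all_order all_algebra.
From mathcomp Require Import all_classical all_reals all_analysis.
From mathcomp Require Import ring lra.
Import Order.TTheory GRing.Theory Num.Theory.
Import numFieldNormedType.Exports.

Set Implicit Arguments.
Unset Strict Implicit.
Unset Printing Implicit Defensive.

Local Open Scope classical_set_scope.
Local Open Scope ring_scope.

(** A positive [eta]-index forces [phi x / x --> rho] (lemma
[self_equivarying_ratio_cvg]), so [x + t * phi x] is asymptotically
[(1 + rho * t) * x] and the Popa group is the multiplicative group of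
positive reals in the coordinate [u = 1 + rho * t]. In that coordinate
membership of [t] in [Au] says that [h (u * x) - h x] has a limit as the pair
[(u, x)] tends jointly to [(1 + rho * t, +oo)] ([AuP] and
[Kincr_joint_dilation]).

The points [u > 0] with such a joint limit form a subgroup: the increment of
[h] over [u * v] is the sum of two increments based at points that both go to
infinity ([dilation_cvgM], [dilation_cvgV]). The subgroup is nonempty, hence
contains [1], where the limit is [0]; thus [h] oscillates slowly. Slow
oscillation transports convergence from a point to its close neighbours up to
an arbitrarily small error, so density together with completeness of the reals
gives a joint limit [k u] at every [u > 0] ([dense_dilation_cvg]).

Finally [s |-> k (expR s)] is additive and, by slow oscillation, bounded near
[0], hence linear ([additive_bounded_near0], [dilation_cvg_log]), so that
[k u = c * ln u]. As [Hdag] agrees with [K] on [Au], which is now the whole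
of [Gplus rho], the formula for [Hdag] follows. *)

(** * The asymptotics of a self-equivarying function *)

(** Working on one neighbourhood of [0] avoids any compactness argument: larger
values of [s] are reached by iterating [x |-> x + a * phi x]. *)
Lemma eta_index_uniform_near0 (R : realType) (phi : R -> R) (rho : R) :
  is_eta_index phi rho ->
  exists2 a : R, 0 < a & forall e : R, 0 < e ->
    \forall x \near +oo, forall s, 0 <= s <= a ->
      `|phi (x + s * phi x) / phi x - (1 + rho * s)| < e.
Proof.
case=> _ [eta [_ phi_eta] etaE].
have [A A0 unifA] := phi_eta 0 (lexx 0).
have /nbhs_ballP[r /= r0 rA] := A0.
exists (r / 2); first by rewrite divr_gt0.
move=> e e0.
have : \forall x \near +oo, forall s, (A `&` `[0, +oo[) s ->
    `|eta s - phi (x + s * phi x) / phi x| < e.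
  apply: (unifA [set g : R -> R | forall s, (A `&` `[0, +oo[) s ->
    `|eta s - g s| < e]).
  apply/uniform_nbhs; exists [set xy | ball xy.1 e xy.2].
  by split=> //; rewrite -entourage_ballE; exists e.
apply: filterS => x hx s /andP[s0 sr].
rewrite -(etaE s s0) distrC; apply: hx; split; last by rewrite /= in_itv/= s0.
by apply: rA; rewrite /ball/= sub0r normrN ger0_norm//; lra.
Qed.

(** Along the iterates [u n] of [x |-> x + a * phi x], the quantity
[g x = phi x - rho * x] moves at each step by at most [e * phi (u n)], which is
[e / a] times the length of the step. These errors therefore telescope to
[e / a * (u n - x0)], linear in the distance covered with a small slope. The
condition [e <= rho * a] keeps [phi] from decreasing along the iterates, so that
they go to infinity and their consecutive intervals cover [[x0, +oo[]; a point
inside such an interval costs one more error [e * phi (u n)]. *)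
Lemma iteration_estimate (R : realType) (phi : R -> R) (rho a e x0 : R) :
  0 < rho -> 0 < a -> 0 < e -> e <= rho * a ->
  0 < x0 -> (forall x, 0 < x -> 0 < phi x) ->
  (forall x, x0 <= x -> forall s, 0 <= s <= a ->
      `|phi (x + s * phi x) / phi x - (1 + rho * s)| < e) ->
  forall x, x0 <= x -> `|phi x - rho * x| <=
    (1 + e) * (`|phi x0 - rho * x0| + e / a * (x - x0)) + e * rho * x.
Proof.
move=> rho0 a0 e0 ea x00 phi0 step.
pose g x := phi x - rho * x.
pose B x := `|g x0| + e / a * (x - x0).
have a'0 : 0 < e / a by rewrite divr_gt0.
have B0 x : x0 <= x -> 0 <= B x.
  by move=> xx; rewrite addr_ge0// mulr_ge0 ?subr_ge0// ltW.
have Bmono x y : x <= y -> B x <= B y.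
  by move=> xy; rewrite lerD2l ler_pM2l// lerD2r.
have stepg x s : x0 <= x -> 0 <= s <= a ->
    `|phi (x + s * phi x) - (1 + rho * s) * phi x| <= e * phi x.
  move=> xx sa; have px : 0 < phi x by apply: phi0; exact: lt_le_trans xx.
  have := ltW (step x xx s sa).
  rewrite -[X in _ <= X -> _](mulfK (lt0r_neq0 px)).
  rewrite ler_pdivlMr// -[X in _ * X <= _ -> _](gtr0_norm px) -normrM mulrBl.
  by rewrite divfK// lt0r_neq0.
have gstep x s : x0 <= x -> 0 <= s <= a ->
    `|g (x + s * phi x) - g x| <= e * phi x.
  by move=> xx /(stepg _ _ xx); apply: le_trans; rewrite /g le_eqVlt;
     apply/orP; left; apply/eqP; congr `|_|; ring.
pose u n := iter n (fun x => x + a * phi x) x0.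
have aa : 0 <= a <= a by rewrite lexx ltW.
have uP n : [/\ x0 + n%:R * (a * phi x0) <= u n, phi x0 <= phi (u n),
    `|g (u n)| <= B (u n) &
    forall x, x0 <= x <= u n -> `|g x| <= (1 + e) * B x + e * rho * x].
  have px0 := phi0 _ x00.
  elim: n => [|n [un pun gun IH]].
    split=> //; first by rewrite mul0r addr0.
      by rewrite /B subrr mulr0 addr0.
    move=> x xx; have -> : x = x0 by apply/eqP; rewrite eq_le andbC.
    rewrite /B subrr mulr0 addr0 mulrDl mul1r -addrA lerDl.
    by rewrite addr_ge0// !mulr_ge0// ltW.
  have uE : u n.+1 = u n + a * phi (u n) by [].
  have x0u : x0 <= u n.
    by apply: le_trans un; rewrite lerDl !mulr_ge0// ltW.
  have pu : 0 < phi (u n) by exact: lt_le_trans pun.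
  have apu : a * phi x0 <= a * phi (u n) by rewrite ler_pM2l.
  split.
  - by rewrite uE -natr1 mulrDl mul1r addrA lerD.
  - have := stepg _ _ x0u aa; rewrite -uE => /ler_normlP[+ _].
    have : e * phi (u n) <= rho * a * phi (u n) by rewrite ler_pM2r.
    lra.
  - have := gstep _ _ x0u aa; rewrite -uE => gu.
    have -> : B (u n.+1) = B (u n) + e * phi (u n).
      by rewrite /B uE; field; exact: lt0r_neq0.
    by rewrite -[g (u n.+1)](subrK (g (u n))) addrC
      (le_trans (ler_normD _ _))// lerD.
  - move=> x /andP[xx xu]; have [xun|/ltW unx] := lerP x (u n).
      by apply: IH; rewrite xx.
    pose s := (x - u n) / phi (u n).
    have xE : x = u n + s * phi (u n).
      by rewrite /s divfK ?lt0r_neq0// addrC subrK.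
    have sa : 0 <= s <= a.
      rewrite divr_ge0 ?subr_ge0 ?(ltW pu)//= ler_pdivrMr//.
      by rewrite lerBlDl -uE.
    have := gstep _ _ x0u sa; rewrite -xE => gx.
    have pB : phi (u n) <= rho * x + B x.
      have -> : phi (u n) = rho * u n + g (u n) by rewrite /g addrC subrK.
      rewrite lerD ?ler_pM2l//; apply: le_trans (Bmono _ _ unx).
      exact: le_trans (ler_norm _) gun.
    have epB : e * phi (u n) <= e * (rho * x + B x) by rewrite ler_pM2l.
    have gB : `|g (u n)| <= B x by exact: le_trans (Bmono _ _ unx).
    have : `|g x| <= `|g (u n)| + `|g x - g (u n)|.
      by rewrite -[in X in X <= _](subrK (g (u n)) (g x)) addrC ler_normD.
    lra.
move=> x xx.
have ap0 : 0 < a * phi x0 by rewrite mulr_gt0// phi0.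
have [n nx] : exists n, x <= u n.
  (* the iterates grow at least linearly, with steps of length a * phi x0 *)
  exists (Num.truncn ((x - x0) / (a * phi x0))).+1.
  have [+ _ _ _] := uP (Num.truncn ((x - x0) / (a * phi x0))).+1.
  apply: le_trans; rewrite -lerBlDl -ler_pdivrMr//.
  by apply/ltW; rewrite truncnS_gt.
by have [_ _ _] := uP n; apply; rewrite xx.
Qed.

(** Letting [e] tend to [0] in [iteration_estimate] with [a] fixed makes the
slope of the bound on [phi x - rho * x] arbitrarily small. *)
Lemma self_equivarying_ratio_cvg (R : realType) (phi : R -> R) (rho : R) :
  (forall x, 0 < x -> 0 < phi x) -> is_eta_index phi rho -> 0 < rho ->
  phi x / x @[x --> +oo] --> rho.
Proof.
move=> phi0 /eta_index_uniform_near0[a a0 unifa] rho0.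
apply/cvgrPdist_le => eps eps0.
(* the slope left by iteration_estimate is at most e * (2 / a + rho), and e is
   chosen to make it eps / 2; the constant term is absorbed for x large *)
pose e := Num.min (Num.min 1 (rho * a)) (eps / (2 * (2 / a + rho))).
have D0 : 0 < 2 * (2 / a + rho) by rewrite mulr_gt0// addr_gt0// divr_gt0.
have e0 : 0 < e by rewrite !lt_min ltr01 mulr_gt0// divr_gt0.
have e1 : e <= 1 by rewrite !ge_min lexx.
have ea : e <= rho * a by rewrite !ge_min lexx orbT.
have eeps : e * (2 * (2 / a + rho)) <= eps.
  by rewrite -ler_pdivlMr// ge_min lexx orbT.
have [M [_ MP]] := unifa e e0.
pose x0 := Num.max 1 (M + 1).
have x00 : 0 < x0 by rewrite lt_max ltr01.
have Mx0 : M < x0 by rewrite lt_max ltrDl ltr01 orbT.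
have est := iteration_estimate rho0 a0 e0 ea x00 phi0
  (fun x xx => MP x (lt_le_trans Mx0 xx)).
near=> x.
have x0x : x0 <= x by near: x; exact: nbhs_pinfty_ge (num_real _).
have x_gt0 : 0 < x by exact: lt_le_trans x0x.
have gx : 4 * `|phi x0 - rho * x0| / eps <= x.
  by near: x; exact: nbhs_pinfty_ge (num_real _).
rewrite ler_pdivrMr// in gx.
have -> : rho - phi x / x = - ((phi x - rho * x) / x).
  by field; exact: lt0r_neq0.
rewrite normrN normrM normfV (gtr0_norm x_gt0) ler_pdivrMr//.
apply: le_trans (est x x0x) _.
set G := `|phi x0 - rho * x0| in gx *.
have B0 : 0 <= G + e / a * (x - x0).
  by rewrite addr_ge0 ?normr_ge0// mulr_ge0 ?subr_ge0// divr_ge0// ltW.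
have h1 : (1 + e) * (G + e / a * (x - x0)) <= 2 * (G + e / a * (x - x0)).
  by rewrite ler_wpM2r//; lra.
have h2 : e / a * (x - x0) <= e / a * x.
  by rewrite ler_wpM2l ?divr_ge0 ?ltW//; lra.
have h3 : e * (2 * (2 / a + rho)) * x <= eps * x by rewrite ler_wpM2r// ltW.
have h4 : e * (2 * (2 / a + rho)) * x = 4 * (e / a * x) + 2 * (e * rho * x).
  by ring.
lra.
Unshelve. all: by end_near. Qed.

(** * The group of dilations with a joint limit *)

Lemma cvg_mul_pinfty (R : realType) (T : Type) (F : set_system T)
    {FF : Filter F} (f g : T -> R) (u : R) :
  0 < u -> f @ F --> u -> g @ F --> +oo -> f x * g x @[x --> F] --> +oo.
Proof.
move=> u0 fu goo; apply/cvgryPge => M.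
near=> x.
have fx : u / 2 < f x.
  near: x; have := fu [set y | u / 2 < y]; apply.
  by apply: lt_nbhsr; lra.
have gx : Num.max 0 (M / (u / 2)) <= g x.
  by near: x; move/cvgryPge : goo; exact.
have /andP[gx0] : (0 <= g x) && (M / (u / 2) <= g x) by rewrite -ge_max.
rewrite ler_pdivrMr; last lra.
move=> Mg; apply: le_trans Mg _; rewrite mulrC ler_wpM2r// ltW//.
Unshelve. all: by end_near. Qed.

Definition dilation_incr (R : realType) (h : R -> R) (p : R * R) : R :=
  h (p.1 * p.2) - h p.2.

(** Karamata's form of the convergence in [Au]: the limit is joint in the dilation
factor and the base point, which is uniformity near [u]. Filters on the
product make changes of variables in the pair plain compositions of limits. *)
Definition dilation_cvg (R : realType) (h : R -> R) (u k : R) : Prop :=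
  dilation_incr h @ filter_prod (nbhs u) +oo --> k.

Section Dilation.
Context {R : realType} (h : R -> R).

Lemma dilation_cvg_at (u k : R) (T : Type) (F : set_system T) {FF : Filter F}
    (f g : T -> R) : dilation_cvg h u k -> f @ F --> u -> g @ F --> +oo ->
  h (f x * g x) - h (g x) @[x --> F] --> k.
Proof.
move=> huk fu goo.
exact: (cvg_comp _ _ (cvg_pair fu goo) huk).
Qed.

(** Writing a factor near [u * v] as [u * (p / u)] splits the increment of [h]
into one over [u] based at [(p / u) * x] and one over [p / u] based at [x]. *)
Lemma dilation_cvgM (u v k l : R) : 0 < u -> 0 < v ->
  dilation_cvg h u k -> dilation_cvg h v l -> dilation_cvg h (u * v) (k + l).
Proof.
move=> u0 v0 huk hvl; have un0 := lt0r_neq0 u0.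
pose F := filter_prod (nbhs (u * v)) (pinfty_nbhs R).
have FF : Filter F by exact: filter_prod_filter.
have f1 : p.1 / u @[p --> F] --> v.
  rewrite -[v in _ --> v](mulKf un0) mulrC.
  by apply: cvgMl; exact: cvg_fst.
have f2 : p.2 @[p --> F] --> +oo by exact: cvg_snd.
have c2 : h (p.1 / u * p.2) - h p.2 @[p --> F] --> l.
  exact: dilation_cvg_at hvl f1 f2.
have c1 : h (u * (p.1 / u * p.2)) - h (p.1 / u * p.2) @[p --> F] --> k.
  by apply: dilation_cvg_at huk (cvg_cst u) _; exact: cvg_mul_pinfty v0 f1 f2.
rewrite /dilation_cvg; apply: cvg_trans (cvgD c1 c2).
apply: (@near_eq_cvg _ _ F); near=> p.
rewrite /dilation_incr /= !fctE addrA subrK; congr (h _ - _).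
by field.
Unshelve. all: by end_near. Qed.

(** The increment over a factor [l] near [u^-1], based at [x], is minus the
increment over [l^-1] based at [l * x]. *)
Lemma dilation_cvgV (u k : R) : 0 < u ->
  dilation_cvg h u k -> dilation_cvg h u^-1 (- k).
Proof.
move=> u0 huk; have un0 := lt0r_neq0 u0.
pose F := filter_prod (nbhs u^-1) (pinfty_nbhs R).
have FF : Filter F by exact: filter_prod_filter.
have f1 : p.1 @[p --> F] --> u^-1 by exact: cvg_fst.
have vu : 0 < u^-1 by rewrite invr_gt0.
have f2 : (p.1)^-1 @[p --> F] --> u.
  by rewrite -[u in _ --> u]invrK; apply: cvgV => //; rewrite invr_eq0.
have f3 : p.2 @[p --> F] --> +oo by exact: cvg_snd.
have c : h (p.1^-1 * (p.1 * p.2)) - h (p.1 * p.2) @[p --> F] --> k.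
  by apply: dilation_cvg_at huk f2 _; exact: cvg_mul_pinfty vu f1 f3.
rewrite /dilation_cvg; apply: cvg_trans (cvgN c).
apply: (@near_eq_cvg _ _ F); near=> p.
have p0 : p.1 != 0.
  rewrite lt0r_neq0//; near: p.
  exact: (f1 [set y | 0 < y] (lt_nbhsr vu)).
by rewrite /dilation_incr /= !fctE opprB mulKf.
Unshelve. all: by end_near. Qed.

Lemma dilation_cvg_unique (u k l : R) :
  dilation_cvg h u k -> dilation_cvg h u l -> k = l.
Proof.
have FF : ProperFilter (filter_prod (nbhs u) (pinfty_nbhs R)).
  exact: filter_prod_proper.
by move=> huk hul; exact: (cvg_unique _ huk hul).
Qed.

Lemma dilation_cvg1 (u k : R) : 0 < u -> dilation_cvg h u k ->
  dilation_cvg h 1 0.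
Proof.
move=> u0 huk; rewrite -(divff (lt0r_neq0 u0)) -(subrr k).
by apply: dilation_cvgM => //; [rewrite invr_gt0|exact: dilation_cvgV].
Qed.

(** A single joint limit yields slow oscillation, that is, the joint limit [0] at
[1]. For [u] close to [w] the increments over factors near [w] then differ by
little from those over [u], which converge to some [k]; the joint increments at
[w] are thus eventually within any [e] of a constant, i.e. Cauchy. *)
Lemma dense_dilation_cvg (w : R) : 0 < w ->
  (forall B, nbhs w B -> exists2 u, B u & exists k, dilation_cvg h u k) ->
  exists k, dilation_cvg h w k.
Proof.
move=> w0 dense.
have h1 : dilation_cvg h 1 0.
  have [u u0 [k]] := dense _ (lt_nbhsr w0).
  exact: dilation_cvg1.
pose F := filter_prod (nbhs w) (pinfty_nbhs R).
have FF : ProperFilter F by exact: filter_prod_proper.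
suff /cvg_ex[k hk] : cvg (dilation_incr h @ F) by exists k.
apply: cauchy_cvg; apply: cauchy_exP => e e0.
have e20 : 0 < e / 2 by rewrite divr_gt0.
have [[P Q] /= [P1 Qoo] PQ] :=
  (cvgrPdist_lt (dilation_incr h) 0).1 h1 _ e20.
have quot1 : p.2 / p.1 @[p --> filter_prod (nbhs w) (nbhs w)] --> (1 : R).
  rewrite -(divff (lt0r_neq0 w0)); apply: cvgM; first exact: cvg_snd.
  by apply: cvgV; [exact: lt0r_neq0|exact: cvg_fst].
have [[A B] /= [Aw Bw] AB] := quot1 _ P1.
have [u [u0 Au] [k huk]] := dense _ (filterI (lt_nbhsr w0) Aw).
exists k.
have f1 : p.1 @[p --> F] --> w by exact: cvg_fst.
have upoo : u * p.2 @[p --> F] --> +oo.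
  by apply: cvg_mul_pinfty u0 (cvg_cst u) _; exact: cvg_snd.
have c : h (u * p.2) - h p.2 @[p --> F] --> k.
  by apply: dilation_cvg_at huk (cvg_cst u) _; exact: cvg_snd.
have /cvgrPdist_lt/(_ _ e20) ce := c.
near=> p.
have pB : B p.1 by near: p; exact: (f1 B Bw).
have pQ : Q (u * p.2) by near: p; exact: (upoo Q Qoo).
have := PQ (p.1 / u, u * p.2) (conj (AB (u, p.1) (conj Au pB)) pQ).
have : `|k - (h (u * p.2) - h p.2)| < e / 2 by near: p.
rewrite /ball /dilation_incr /= sub0r normrN mulrA divfK ?lt0r_neq0// => k1 k2.
have -> : k - (h (p.1 * p.2) - h p.2) =
    (k - (h (u * p.2) - h p.2)) - (h (p.1 * p.2) - h (u * p.2)) by ring.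
by rewrite [e]splitr; apply: le_lt_trans (ler_normB _ _) (ltrD k1 k2).
Unshelve. all: by end_near. Qed.

End Dilation.

(** * Logarithmic form of the limit *)

(** The difference [D] of [L] and [x |-> L 1 * x] is additive and vanishes on the
integers, hence is [1]-periodic. Boundedness near [0] spreads to [[0, 1]] by
scaling, then to all [x >= 0] by periodicity; but [D (n * x) = n * D x] is bounded
in [n] only if [D x = 0]. *)
Lemma additive_bounded_near0 (R : realType) (L : {additive R -> R}) :
  (exists M, \forall x \near 0, `|L x| <= M) -> forall x, L x = L 1 * x.
Proof.
move=> [M /nbhs_ballP[d /= d0 LM]].
pose D x := L x - L 1 * x.
have DD x y : D (x + y) = D x + D y by rewrite /D raddfD; ring.
have DM n x : D (n%:R * x) = n%:R * D x.
  by rewrite /D raddfMnat; ring.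
have Dn n : D n%:R = 0.
  by rewrite -[n%:R]mulr1 DM /D mulr1 subrr mulr0.
have DN x : D (- x) = - D x by rewrite /D raddfN; ring.
pose m := (Num.truncn d^-1).+1.
have m0 : 0 < m%:R :> R by rewrite ltr0n.
have md : m%:R^-1 < d.
  by rewrite invf_plt ?posrE// /m truncnS_gt.
pose C := m%:R * (M + `|L 1|).
have bnd01 x : 0 <= x <= 1 -> `|D x| <= C.
  move=> /andP[x0 x1].
  have -> : x = m%:R * (x / m%:R) by rewrite mulrC divfK// lt0r_neq0.
  rewrite DM normrM gtr0_norm// ler_pM2l// (le_trans (ler_normB _ _))//.
  have xm : 0 <= x / m%:R <= m%:R^-1.
    by rewrite divr_ge0 ?(ltW m0)//= ler_piMl// invr_ge0 ltW.
  have /andP[xm0 xm1] := xm.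
  have m1 : m%:R^-1 <= 1 :> R by rewrite invf_le1// ler1n.
  rewrite lerD//; first apply: LM.
    by rewrite /ball/= sub0r normrN ger0_norm//; exact: le_lt_trans md.
  by rewrite normrM ler_piMr// ger0_norm//; exact: le_trans m1.
have bnd x : 0 <= x -> `|D x| <= C.
  move=> x0; rewrite -[x](subrK (Num.truncn x)%:R) DD Dn addr0.
  apply: bnd01; have /andP[? ?] := truncn_itv x0.
  by rewrite subr_ge0 lerBlDl natr1; apply/andP; split=> //; exact: ltW.
have D0 x : 0 <= x -> D x = 0.
  move=> x0; apply/eqP; rewrite -normr_le0 leNgt; apply/negP => Dx.
  have := bnd ((Num.truncn (C / `|D x|)).+1%:R * x) (mulr_ge0 (ler0n _ _) x0).
  rewrite DM normrM ger0_norm// leNgt -ltr_pdivrMr// => /negP; apply.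
  exact: truncnS_gt.
move=> x; apply/eqP; rewrite -subr_eq0; apply/eqP; rewrite -/(D x).
have [x0|/ltW x0] := lerP 0 x; first exact: D0.
by rewrite -[x]opprK DN D0 ?oppr0// oppr_ge0.
Qed.

Lemma dilation_cvg_log (R : realType) (h k : R -> R) :
  (forall w, 0 < w -> dilation_cvg h w (k w)) ->
  exists c, forall w, 0 < w -> k w = c * ln w.
Proof.
move=> hk.
have kM u v : 0 < u -> 0 < v -> k (u * v) = k u + k v.
  move=> u0 v0; apply: dilation_cvg_unique (hk _ (mulr_gt0 u0 v0)) _.
  by apply: dilation_cvgM => //; exact: hk.
have k1 : k 1 = 0 by have := kM 1 1 ltr01 ltr01; rewrite mulr1; lra.
pose L s := k (expR s).
have LB : {morph L : x y / x - y}.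
  move=> x y; have := kM (expR (x - y)) (expR y) (expR_gt0 _) (expR_gt0 _).
  by rewrite -expRD subrK /L; lra.
pose Ladd : {additive R -> R} :=
  HB.pack L (GRing.isZmodMorphism.Build R R L LB).
(* slow oscillation: increments over factors near 1 are eventually below 1,
   and so are their limits *)
have bndL : exists M, \forall s \near 0, `|Ladd s| <= M.
  exists 1.
  have h1 := hk 1 ltr01; rewrite k1 in h1.
  have [[P Q] /= [P1 Qoo] PQ] :=
    (cvgrPdist_lt (dilation_incr h) 0).1 h1 1 ltr01.
  have exp1 : expR s @[s --> (0 : R)] --> (1 : R).
    by rewrite -expR0; exact: continuous_expR.
  have : \forall s \near (0 : R), P (expR s) by exact: (exp1 P P1).
  apply: filterS => s Ps.
  have hs : h (expR s * x) - h x @[x --> +oo] --> L s.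
    by apply: dilation_cvg_at (hk _ (expR_gt0 s)) (cvg_cst _) _; exact: cvg_id.
  change (`|L s| <= 1); apply: (cvgr_to_le (cvg_norm hs)).
  apply: filterS Qoo => x Qx.
  have := PQ (expR s, x) (conj Ps Qx).
  by rewrite /dilation_incr /= sub0r normrN; exact: ltW.
exists (L 1) => w w0.
have /= := additive_bounded_near0 bndL (ln w).
by rewrite /L lnK.
Qed.

(** * From the Popa group to dilations *)

Section Bridge.
Context {R : realType} (phi h : R -> R) (rho : R).

Lemma Kincr_joint_K (t k : R) :
  Kincr phi h p.1 p.2 @[p --> filter_prod (nbhs t) (pinfty_nbhs R)] --> k ->
  Kincr phi h t x @[x --> +oo] --> k.
Proof.
move=> hk.
have tx : (t, x) @[x --> +oo] --> filter_prod (nbhs t) (pinfty_nbhs R).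
  exact: (cvg_pair (cvg_cst t) cvg_id).
exact: (cvg_comp _ _ tx hk).
Qed.

Lemma AuP (t : R) : Gplus rho t ->
  Au rho phi h t <-> exists k : R, Kincr phi h p.1 p.2
    @[p --> filter_prod (nbhs t) (pinfty_nbhs R)] --> k.
Proof.
move=> Gt; split.
  move=> [_ _ unif]; exists (K phi h t).
  apply/cvgrPdist_lt => e e0; have [d d0 near_d] := unif e e0.
  exists (ball t d, [set x | forall s, s \in `]t - d, t + d[ ->
          `|Kincr phi h s x - K phi h t| < e]).
    by split=> //; exact: nbhsx_ballx.
  move=> [s x] /= [tsd hx]; rewrite distrC; apply: hx.
  by rewrite in_itv/= -ltr_distlC.
move=> [k hk]; have hkt := Kincr_joint_K hk.
have KE : K phi h t = k by apply/cvg_lim.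
split=> //; first by apply/cvg_ex; exists k.
move=> e e0; rewrite KE.
have [[P Q] /= [/nbhs_ballP[d /= d0 dP] Qoo] PQ] :=
  (cvgrPdist_lt (fun p => Kincr phi h p.1 p.2) k).1 hk e e0.
exists d => //; apply: filterS Qoo => x Qx s.
rewrite in_itv/= -ltr_distlC => sd; rewrite distrC.
by apply: (PQ (s, x)); split => //; exact: dP.
Qed.

(** The substitutions [(s, x) |-> (1 + s * phi x / x, x)] and
[(l, x) |-> ((l - 1) * x / phi x, x)] are mutually inverse, and since
[phi x / x --> rho] they tend to [(1 + rho * t, +oo)] and [(t, +oo)]. *)
Lemma Kincr_joint_dilation (t k : R) : 0 < rho ->
  phi x / x @[x --> +oo] --> rho ->
  (Kincr phi h p.1 p.2 @[p --> filter_prod (nbhs t) (pinfty_nbhs R)] --> k)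
  <-> dilation_cvg h (1 + rho * t) k.
Proof.
move=> rho0 phirho; split => hk.
- pose F := filter_prod (nbhs (1 + rho * t)) (pinfty_nbhs R).
  have FF : Filter F by exact: filter_prod_filter.
  have c2 : p.2 @[p --> F] --> +oo by exact: cvg_snd.
  have c1 : p.1 @[p --> F] --> 1 + rho * t by exact: cvg_fst.
  have cphi : phi p.2 / p.2 @[p --> F] --> rho.
    exact: (cvg_comp _ _ c2 phirho).
  have cs : (p.1 - 1) / (phi p.2 / p.2) @[p --> F] --> t.
    have -> : t = (1 + rho * t - 1) / rho by field; exact: lt0r_neq0.
    apply: cvgM; first by apply: cvgB => //; exact: cvg_cst.
    by apply: cvgV => //; exact: lt0r_neq0.
  have c : Kincr phi h ((p.1 - 1) / (phi p.2 / p.2)) p.2 @[p --> F] --> k.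
    exact: (cvg_comp _ _ (cvg_pair cs c2) hk).
  rewrite /dilation_cvg; apply: cvg_trans c.
  apply: (@near_eq_cvg _ _ F); near=> p.
  have p0 : 0 < p.2.
    near: p; exact: (c2 [set y | 0 < y] (nbhs_pinfty_gt (num_real _))).
  have q0 : 0 < phi p.2 / p.2.
    near: p; exact: (cphi [set y | 0 < y] (lt_nbhsr rho0)).
  rewrite /Kincr /dilation_incr /=; congr (h _ - _).
  have phi0 : phi p.2 != 0.
    by apply: contraTneq q0 => ->; rewrite mul0r ltxx.
  by field; rewrite phi0 lt0r_neq0.
- pose F := filter_prod (nbhs t) (pinfty_nbhs R).
  have FF : Filter F by exact: filter_prod_filter.
  have c2 : p.2 @[p --> F] --> +oo by exact: cvg_snd.
  have c1 : p.1 @[p --> F] --> t by exact: cvg_fst.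
  have cphi : phi p.2 / p.2 @[p --> F] --> rho.
    exact: (cvg_comp _ _ c2 phirho).
  have cl : 1 + phi p.2 / p.2 * p.1 @[p --> F] --> 1 + rho * t.
    by apply: cvgD; [exact: cvg_cst|exact: cvgM].
  have c : h ((1 + phi p.2 / p.2 * p.1) * p.2) - h p.2 @[p --> F] --> k.
    exact: dilation_cvg_at hk cl c2.
  apply: cvg_trans c; apply: (@near_eq_cvg _ _ F); near=> p.
  have p0 : 0 < p.2.
    near: p; exact: (c2 [set y | 0 < y] (nbhs_pinfty_gt (num_real _))).
  by rewrite /Kincr /=; congr (h _ - _); field; exact: lt0r_neq0.
Unshelve. all: by end_near. Qed.

End Bridge.

Lemma GplusE (R : realType) (rho t : R) : 0 < rho ->
  Gplus rho t <-> 0 < 1 + rho * t.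
Proof.
move=> rho0; rewrite /Gplus /rho_star /= in_itv /= andbT.
rewrite ltrNl -(ltr_pM2l rho0) divff ?lt0r_neq0//.
rewrite mulrN; split; lra.
Qed.

Theorem theorem6 (R : realType) (phi : R -> R) (rho : R) (h : R -> R)
    (hphi : self_equivarying phi)
    (hidx : is_eta_index phi rho) (hrho : 0 < rho)
    (hdense : Gplus rho `<=` closure (Au rho phi h))
    (hHK : forall t : R, Au rho phi h t -> Hdag phi h t = (K phi h t)%:E) :
  Au rho phi h = Gplus rho /\
  exists c : R, forall t : R, rho_star rho < t ->
    Hdag phi h t = (c * ln (1 + rho * t))%:E.
Proof.
have [phi_gt0 _ _] := hphi.
have phirho := self_equivarying_ratio_cvg phi_gt0 hidx hrho.
have AuE t : Gplus rho t ->
    Au rho phi h t <-> exists k, dilation_cvg h (1 + rho * t) k.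
  move=> Gt; split=> [/(AuP _ _ Gt)[k hk]|[k hk]].
    by exists k; exact/(Kincr_joint_dilation _ _ _ hrho phirho).
  apply/(AuP _ _ Gt); exists k.
  exact/(Kincr_joint_dilation _ _ _ hrho phirho).
have rhoV (w : R) : 1 + rho * ((w - 1) / rho) = w.
  by field; exact: lt0r_neq0.
have total w : 0 < w -> exists k, dilation_cvg h w k.
  move=> w0; apply: dense_dilation_cvg => // B wB.
  have Gw : Gplus rho ((w - 1) / rho) by apply/GplusE; rewrite ?rhoV.
  (* t |-> 1 + rho * t pulls neighbourhoods of w back to the point where
   density of Au applies *)
have cB : (1 + rho * t) @[t --> (w - 1) / rho] --> w.
    rewrite -[in X in _ --> X](rhoV w).
    by apply: cvgD; [exact: cvg_cst|apply: cvgMr; exact: cvg_id].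
  have [t [At Bt]] := hdense _ Gw _ (cB _ wB).
  by exists (1 + rho * t) => //; apply/(AuE t) => //; case: At.
have AuG : Au rho phi h = Gplus rho.
  apply/seteqP; split=> [t []//|t Gt]; apply/AuE => //.
  by apply: total; apply/GplusE.
split=> //.
have total_choice w : exists l, 0 < w -> dilation_cvg h w l.
  have [/total[l hl]|w0] := ltrP 0 w; first by exists l.
  by exists 0.
have [k hk] := choice total_choice.
have [c kc] := dilation_cvg_log hk.
exists c => t tG; have Gt : Gplus rho t by rewrite /Gplus /= in_itv/= tG.
have w0 : 0 < 1 + rho * t by apply/GplusE.
rewrite hHK ?AuG// -kc//; congr (_%:E); apply/cvg_lim => //.
apply: Kincr_joint_K; apply/(Kincr_joint_dilation _ _ _ hrho phirho).
exact: hk.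
Qed.
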